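(* Fix $J\ge 2$ and sample sizes $n_1,\ldots,n_J$ with $\min_j n_j\ge 2$. For each dimension $d$, let $F_1,\ldots,F_J$ be distributions on $\mathbb{R}^d$ with finite second moments, means $\boldsymbol{\mu}_j$ and covariances $\boldsymbol{\Sigma}_j$, satisfying assumptions (A1) and (A2) stated in the context. Let $\mathbf{X}_{j1},\ldots,\mathbf{X}_{jn_j}\overset{iid}{\sim}F_j$, $j=1,\ldots,J$, be independent collections. Let $\Psi:[0,\infty)\to[0,\infty)$ be a continuous (decreasing) function not depending on $d$, and let $h=h_d$ satisfy $h^2/d\to C_0>0$ as $d\to\infty$. Define the empirical local Mahalanobis distances computed with the identity matrix, $$\widehat\beta_{h,j}(\mathbf{x})=\frac1{n_j}\sum_{i=1}^{n_j}\Psi\Big(\frac{\|\mathbf{x}-\mathbf{X}_{ji}\|^2}{h^2}\Big)\|\mathbf{x}-\mathbf{X}_{ji}\|^2,\qquad \widehat\gamma_j^h(\mathbf{x})=\begin{cases}\widehat\beta_{h,j}(\mathbf{x})& h>1,\\ \widehat\beta_{h,j}(\mathbf{x})/h^{d+2}& h\le1,\end{cases}$$ and $\widehat\Gamma_h(\mathbf{x})=(\widehat\gamma_1^h(\mathbf{x}),\ldots,\widehat\gamma_J^h(\mathbf{x}))$. For $1\le j,j'\le J$ set $\nu_{jj}^2=0$ and $\theta^{0}_{jj'}=\Psi\Big(\frac{\sigma_j^2+\sigma_{j'}^2+\nu_{jj'}^2}{C_0}\Big)(\sigma_j^2+\sigma_{j'}^2+\nu_{jj'}^2)$. Then, as $d\to\infty$: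 (a) for every $j$ and $i=1,\ldots,n_j$, $d^{-1}\widehat\Gamma_h(\mathbf{X}_{ji})\overset{P}{\to}\widetilde\Theta_j=(\widetilde\theta_{j1},\ldots,\widetilde\theta_{jJ})$, where $\widetilde\theta_{jj}=(1-1/n_j)\theta^{0}_{jj}$ and $\widetilde\theta_{jk}=\theta^0_{jk}$ for $k\ne j$; (b) for an observation $\mathbf{Z}\sim F_i$ independent of the samples, $d^{-1}\widehat\Gamma_h(\mathbf{Z})\overset{P}{\to}(\theta^0_{i1},\ldots,\theta^0_{iJ})$.
   Context: Assumption (A1): for all $1\le j,j'\le J$ and independent random vectors $\mathbf{X}\sim F_j$ and $\mathbf{Y},\mathbf{Z}\sim F_{j'}$ (with coordinates $X_i,Y_i,Z_i$), as $d\to\infty$, $\big|d^{-1}\sum_{i=1}^d(X_i-Y_i)(X_i-Z_i)-E\{d^{-1}\sum_{i=1}^d(X_i-Y_i)(X_i-Z_i)\}\big|\overset{P}{\to}0$ and $\big|d^{-1}\sum_{i=1}^d(X_i-Y_i)^2-E\{d^{-1}\sum_{i=1}^d(X_i-Y_i)^2\}\big|\overset{P}{\to}0$. Assumption (A2): for each $j$ there is a constant $\sigma_j^2$ with $d^{-1}\mathrm{trace}(\boldsymbol{\Sigma}_j)\to\sigma_j^2$, and for each $j\ne j'$ there is a constant $\nu_{jj'}^2$ with $d^{-1}\|\boldsymbol{\mu}_j-\boldsymbol{\mu}_{j'}\|^2\to\nu_{jj'}^2$, as $d\to\infty$. The sample sizes $n_j$ stay fixed as $d\to\infty$. *)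

(* Defs.v *)
From HB Require Import structures.
From mathcomp Require Import all_boot all_order all_algebra.
From mathcomp Require Import all_classical all_reals all_analysis.
Set Implicit Arguments. Unset Strict Implicit. Unset Printing Implicit Defensive.
Import Order.TTheory GRing.Theory Num.Theory.
Import numFieldNormedType.Exports.
Local Open Scope classical_set_scope.
Local Open Scope ring_scope.

Definition rects (R : realType) (d : nat) : set (set ('I_d -> R)) :=
  [set A | exists B : 'I_d -> set R,
      (forall k, measurable (B k)) /\ A = [set x | forall k, B k (x k)]].

(** R^d with its Borel (= product) sigma-algebra. *)
Definition Rd (R : realType) (d : nat) := g_sigma_algebraType (@rects R d).
Arguments Rd : clear implicits.

Definition sqdist (R : realType) (d : nat) (x y : 'I_d -> R) : R :=
  \sum_(k < d) (x k - y k) ^+ 2.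

Definition has_law (R : realType) (dT : measure_display) (T : measurableType dT)
  (P : probability T R) (d : nat) (X : T -> Rd R d) (F : probability (Rd R d) R) :=
  measurable_fun setT X /\
  forall A : set (Rd R d), measurable A -> P (X @^-1` A) = F A.

Definition mutually_independent (R : realType) (dT : measure_display)
  (T : measurableType dT) (P : probability T R) (d : nat) (I : finType)
  (X : I -> T -> Rd R d) :=
  forall A : I -> set (Rd R d), (forall i, measurable (A i)) ->
    P (\bigcap_(i in [set: I]) (X i @^-1` A i)) =
    (\prod_(i in I) P (X i @^-1` A i))%E.

Definition mean_vec (R : realType) (d : nat) (F : probability (Rd R d) R)
  (k : 'I_d) : R := fine (\int[F]_x ((x k)%:E))%E.

Definition trace_cov (R : realType) (d : nat) (F : probability (Rd R d) R) : R :=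
  \sum_(k < d) (fine (\int[F]_x (((x k) ^+ 2)%:E))%E - (mean_vec F k) ^+ 2).

Definition finite_second_moments (R : realType) (d : nat)
  (F : probability (Rd R d) R) :=
  forall k : 'I_d, F.-integrable setT (fun x : Rd R d => ((x k) ^+ 2)%:E).

Definition cvg_prob_seq (R : realType) (T : nat -> Type)
  (P : forall d, set (T d) -> \bar R) (W : forall d, T d -> R) (c : nat -> R) :=
  forall eps : R, 0 < eps ->
    (fun d => P d [set w | eps <= `|W d w - c d|]) @ \oo --> 0%E.

Definition cvg_vec_prob (R : realType) (J : nat) (T : nat -> Type)
  (P : forall d, set (T d) -> \bar R) (V : forall d, T d -> 'I_J -> R)
  (theta : 'I_J -> R) :=
  forall eps : R, 0 < eps ->
    (fun d => P d [set w | exists k, eps <= `|V d w k - theta k|]) @ \oo --> 0%E.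

(** The joint law of independent X ~ F, Y ~ G, Z ~ G on R^d x (R^d x R^d). *)
Definition triple_law (R : realType) (d : nat) (F G : probability (Rd R d) R) :=
  (F \x (G \x G))%E.

Definition W1 (R : realType) (d : nat) (w : Rd R d * (Rd R d * Rd R d)) : R :=
  d%:R^-1 * \sum_(k < d) (w.1 k - w.2.1 k) * (w.1 k - w.2.2 k).

Definition W2 (R : realType) (d : nat) (w : Rd R d * (Rd R d * Rd R d)) : R :=
  d%:R^-1 * \sum_(k < d) (w.1 k - w.2.1 k) ^+ 2.

Definition assumption_A1 (R : realType) (J : nat)
  (F : forall d, 'I_J -> probability (Rd R d) R) :=
  forall j j' : 'I_J,
    cvg_prob_seq (fun d => triple_law (F d j) (F d j')) (@W1 R)
      (fun d => fine (\int[triple_law (F d j) (F d j')]_w (W1 w)%:E)%E) /\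
    cvg_prob_seq (fun d => triple_law (F d j) (F d j')) (@W2 R)
      (fun d => fine (\int[triple_law (F d j) (F d j')]_w (W2 w)%:E)%E).

Definition assumption_A2 (R : realType) (J : nat)
  (F : forall d, 'I_J -> probability (Rd R d) R)
  (sigma2 : 'I_J -> R) (nu2 : 'I_J -> 'I_J -> R) :=
  (forall j, (fun d => d%:R^-1 * trace_cov (F d j)) @ \oo --> sigma2 j) /\
  (forall j j', j != j' ->
     (fun d => d%:R^-1 * \sum_(k < d) (mean_vec (F d j) k - mean_vec (F d j') k) ^+ 2)
       @ \oo --> nu2 j j').

Definition beta_hat (R : realType) (d : nat) (Psi : R -> R) (h : R) (nj : nat)
  (Xs : 'I_nj -> Rd R d) (x : Rd R d) : R :=
  nj%:R^-1 * \sum_(i < nj) Psi (sqdist x (Xs i) / h ^+ 2) * sqdist x (Xs i).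

Definition gamma_hat (R : realType) (d : nat) (Psi : R -> R) (h : R) (nj : nat)
  (Xs : 'I_nj -> Rd R d) (x : Rd R d) : R :=
  if 1 < h then beta_hat Psi h Xs x else beta_hat Psi h Xs x / h ^+ (d + 2).

Definition theta0 (R : realType) (J : nat) (Psi : R -> R) (C0 : R)
  (sigma2 : 'I_J -> R) (nu2 : 'I_J -> 'I_J -> R) (j j' : 'I_J) : R :=
  let s := sigma2 j + sigma2 j' + (if j == j' then 0 else nu2 j j') in
  Psi (s / C0) * s.

(* Main.v *)
Require Import Defs.
From HB Require Import structures.
From mathcomp Require Import all_boot all_order all_algebra.
From mathcomp Require Import all_classical all_reals all_analysis.
From mathcomp Require Import measurable_realfun ring lra.
Import Order.TTheory GRing.Theory Num.Theory.
Import numFieldNormedType.Exports.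
Local Open Scope classical_set_scope.
Local Open Scope ring_scope.

(** Two independent points with laws F_j and F_k are, at the scale of d, asymptotically
    equidistant in probability: the mean of d^-1 ||X - Y||^2 is d^-1 (tr Sigma_j + tr
    Sigma_k + ||mu_j - mu_k||^2), which converges by (A2), and (A1) says that
    d^-1 ||X - Y||^2 concentrates around its mean.  Since h^2/d tends to C0, each
    summand of d^-1 beta_hat is a continuous function of the two converging
    quantities d^-1 ||X - Y||^2 and h^2/d, so it converges in probability to
    theta0.  The only summand that behaves differently is the one pairing X_ji
    with itself, which vanishes; this produces the factor 1 - 1/n_j.  Finally
    h > 1 for large d, so gamma_hat is eventually beta_hat. *)

(** * Measurability of coordinates and squared distances *)

Lemma measurable_coord (R : realType) (d : nat) (k : 'I_d) :
  measurable_fun setT (fun x : Rd R d => x k).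
Proof.
move=> _ B mB; rewrite setTI; apply: sub_sigma_algebra.
exists (fun l => if l == k then B else setT); split => [l|].
  by case: ifP.
apply/seteqP; split => x /= => [xB l|/(_ k)]; last by rewrite eqxx.
by case: ifP => // /eqP ->.
Qed.

Lemma measurable_sqdist (R : realType) (d : nat) (dT : measure_display)
    (T : measurableType dT) (U V : T -> Rd R d) :
  measurable_fun setT U -> measurable_fun setT V ->
  measurable_fun setT (fun w => sqdist (U w) (V w)).
Proof.
move=> mU mV; apply: measurable_sum => k; apply: measurable_funX.
by apply: measurable_funB;
  [exact: (measurableT_comp (measurable_coord _ _ k) mU)
  |exact: (measurableT_comp (measurable_coord _ _ k) mV)].
Qed.

Lemma sqdist_ge0 (R : realType) (d : nat) (x y : 'I_d -> R) : 0 <= sqdist x y.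
Proof. by apply: sumr_ge0 => k _; exact: sqr_ge0. Qed.

Lemma measurable_dist_ge (R : realType) (dT : measure_display)
    (T : measurableType dT) (f : T -> R) (c eps : R) :
  measurable_fun setT f -> measurable [set w | eps <= `|f w - c|].
Proof.
move=> mf; rewrite (_ : [set _ | _] = (fun w => `|f w - c|) @^-1` `[eps, +oo[).
  rewrite -[X in measurable X]setTI.
  suff : measurable_fun setT (fun w => `|f w - c|) by apply.
  by apply: measurableT_comp => //; exact: measurable_funB.
by apply/seteqP; split => w /=; rewrite in_itv/= andbT.
Qed.

(** * Independence and joint laws of pairs *)

Lemma mutually_independent_pair (R : realType) (dT : measure_display)
    (T : measurableType dT) (P : probability T R) (d : nat) (I : finType)
    (X : I -> T -> Rd R d) (p q : I) (A B : set (Rd R d)) :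
  mutually_independent P X -> p != q -> measurable A -> measurable B ->
  P (X p @^-1` A `&` X q @^-1` B) = (P (X p @^-1` A) * P (X q @^-1` B))%E.
Proof.
move=> indX npq mA mB.
(* Every other index receives the whole space, whose preimage contributes a factor 1 to the
   product. *)
pose C i := if i == p then A else if i == q then B else setT.
have mC i : measurable (C i) by rewrite /C; case: ifP => // _; case: ifP.
have nqp : (q == p) = false by rewrite eq_sym; apply/negbTE.
have := indX C mC; rewrite (bigD1 p)//= (bigD1 q)/=; last by rewrite nqp.
rewrite big1 => [|i /andP[/negbTE ip /negbTE iq]]; last first.
  by rewrite /C ip iq preimage_setT probability_setT.
rewrite mule1 /C eqxx nqp eqxx => <-; congr (P _); apply/seteqP; split => w.
  by move=> [/= wA wB] i _ /=; case: ifP => [/eqP -> //|_]; case: ifP => [/eqP ->|].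
by move=> h; split; [have := h p Logic.I|have := h q Logic.I]; rewrite /= ?nqp eqxx.
Qed.

(** By independence the image of [P] under [(U, V)] agrees with [F \x G] on measurable rectangles,
    and these determine the product measure. *)
Lemma independent_pair_law (R : realType) (dT : measure_display)
    (T : measurableType dT) (P : probability T R) (d : nat)
    (U V : T -> Rd R d) (F G : probability (Rd R d) R) :
  has_law P U F -> has_law P V G ->
  (forall A B, measurable A -> measurable B ->
     P (U @^-1` A `&` V @^-1` B) = (P (U @^-1` A) * P (V @^-1` B))%E) ->
  forall E : set (Rd R d * Rd R d), measurable E ->
    P [set w | E (U w, V w)] = (F \x G)%E E.
Proof.
move=> [mU lU] [mV lV] ind E mE.
have mUV : measurable_fun setT (fun w => (U w, V w)) by exact: measurable_fun_pair.
pose UV := mfun_Sub (mem_set mUV).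
apply/esym/(@product_measure_unique _ _ _ _ _ F G (pushforward P UV)) => //.
by move=> A B mA mB; have := ind A B mA mB; rewrite lU// lV.
Qed.

(** (A1) is phrased on triples, but [W2] ignores the third point; this brings it down to pairs. On a
    rectangle the third factor contributes its total mass 1, and rectangles suffice by
    uniqueness. *)
Lemma product_measure_marginal2 (R : realType) (d1 d2 d3 : measure_display)
    (T1 : measurableType d1) (T2 : measurableType d2) (T3 : measurableType d3)
    (m1 : probability T1 R) (m2 : probability T2 R) (m3 : probability T3 R)
    (E : set (T1 * T2)) : measurable E ->
  (m1 \x (m2 \x m3))%E [set w | E (w.1, w.2.1)] = (m1 \x m2)%E E.
Proof.
move=> mE.
have mproj : measurable_fun setT (fun w : T1 * (T2 * T3) => (w.1, w.2.1)).
  by apply: measurable_fun_pair => //; exact: measurableT_comp.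
pose proj := mfun_Sub (mem_set mproj).
pose m23 : probability (T2 * T3)%type R := (m2 \x m3)%E.
pose m : measure (T1 * (T2 * T3))%type R := (m1 \x m23)%E.
apply/esym/(@product_measure_unique _ _ _ _ _ m1 m2 (pushforward m proj)) => //.
move=> A B mA mB; transitivity (m (A `*` (B `*` setT))); last first.
  rewrite [LHS]product_measure1E//; last exact: measurableX.
  by congr (_ * _)%E; rewrite [LHS]product_measure1E//= probability_setT mule1.
by congr (m _); apply/seteqP; split => -[x [y z]]/=; rewrite /proj/=; tauto.
Qed.

(** * Expectation of the scaled squared distance *)

Lemma integral_quadratic (R : realType) (dT : measure_display)
    (T : measurableType dT) (m : probability T R) (g : T -> R) (a b c : R) :
  measurable_fun setT g -> m.-integrable setT (fun x => (g x ^+ 2)%:E) ->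
  (\int[m]_x (a + b * g x + c * g x ^+ 2)%:E)%E =
  (a + b * fine (\int[m]_x (g x)%:E)%E + c * fine (\int[m]_x (g x ^+ 2)%:E)%E)%:E.
Proof.
move=> mg ig2.
have ic (k : R) : m.-integrable setT (fun=> k%:E).
  exact: finite_measure_integrable_cst.
(* Under a finite measure, square integrability gives integrability through [|g| <= 1 + g ^+ 2], a
   consequence of [(g + 1) ^+ 2] and [(g - 1) ^+ 2] being nonnegative. *)
have ig : m.-integrable setT (fun x => (g x)%:E).
  apply: (@le_integrable _ _ _ m setT _ _ (fun x => (1%:E + (g x ^+ 2)%:E)%E)) => //.
  - exact/measurable_EFinP.
  - move=> x _ /=; rewrite lee_fin ler_norml [`|1 + _|]ger0_norm; last first.
      by rewrite addr_ge0// sqr_ge0.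
    have := sqr_ge0 (g x + 1); have := sqr_ge0 (g x - 1); have := sqr_ge0 (g x).
    by rewrite sqrrB1 sqrrD1 => *; apply/andP; split; lra.
  - exact: integrableD.
under eq_integral do rewrite !EFinD (EFinM b) (EFinM c).
have ibg := integrableZl measurableT b ig.
have icg2 := integrableZl measurableT c ig2.
rewrite integralD//; last exact: integrableD.
rewrite integralD// !integralZl// integral_cst//= probability_setT mule1.
by rewrite !EFinD (EFinM b) (EFinM c) !fineK//; exact: integrable_fin_num.
Qed.

(** The integrand is nonnegative, so Tonelli applies. The third variable integrates to a factor 1,
    and each of the other two leaves a quadratic polynomial in one function. *)
Lemma integral_sqr_diff (R : realType) (d1 d2 d3 : measure_display)
    (T1 : measurableType d1) (T2 : measurableType d2) (T3 : measurableType d3)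
    (m1 : probability T1 R) (m2 : probability T2 R) (m3 : probability T3 R)
    (f : T1 -> R) (g : T2 -> R) :
  measurable_fun setT f -> measurable_fun setT g ->
  m1.-integrable setT (fun x => (f x ^+ 2)%:E) ->
  m2.-integrable setT (fun x => (g x ^+ 2)%:E) ->
  (\int[m1 \x (m2 \x m3)]_w ((f w.1 - g w.2.1) ^+ 2)%:E)%E =
  (fine (\int[m1]_x (f x ^+ 2)%:E)%E
   - 2 * fine (\int[m1]_x (f x)%:E)%E * fine (\int[m2]_x (g x)%:E)%E
   + fine (\int[m2]_x (g x ^+ 2)%:E)%E)%:E.
Proof.
move=> mf mg if2 ig2.
pose m23 : probability (T2 * T3)%type R := (m2 \x m3)%E.
transitivity (\int[m1 \x m23]_w ((f w.1 - g w.2.1) ^+ 2)%:E)%E => //.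
rewrite fubini_tonelli1/=; last 2 first.
- apply/measurable_EFinP; apply: measurable_funX; apply: measurable_funB.
    exact: measurableT_comp.
  by apply: measurableT_comp => //; exact: measurableT_comp.
- by move=> w; rewrite lee_fin sqr_ge0.
(* [a] and [b] are the constant and linear coefficients of the polynomial in [f x] left by the inner
   integral. *)
pose a := fine (\int[m2]_x (g x ^+ 2)%:E)%E.
pose b := - 2 * fine (\int[m2]_x (g x)%:E)%E.
transitivity (\int[m1]_x (a + b * f x + 1 * f x ^+ 2)%:E)%E; last first.
  by rewrite integral_quadratic//; congr EFin; rewrite /a /b; ring.
apply: eq_integral => x _.
rewrite /fubini_F /m23 fubini_tonelli1/=; last 2 first.
- apply/measurable_EFinP; apply: measurable_funX; apply: measurable_funB => //.
  exact: measurableT_comp.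
- by move=> w; rewrite lee_fin sqr_ge0.
transitivity (\int[m2]_y (f x ^+ 2 + (- 2 * f x) * g y + 1 * g y ^+ 2)%:E)%E.
  apply: eq_integral => y _; rewrite /fubini_F/= integral_cst//= probability_setT.
  by rewrite mule1; congr EFin; ring.
by rewrite integral_quadratic//; congr EFin; rewrite /a /b; ring.
Qed.

Lemma integral_sum_sqr_diff (R : realType) (d1 d2 d3 : measure_display)
    (T1 : measurableType d1) (T2 : measurableType d2) (T3 : measurableType d3)
    (m1 : probability T1 R) (m2 : probability T2 R) (m3 : probability T3 R)
    (d : nat) (f : 'I_d -> T1 -> R) (g : 'I_d -> T2 -> R) (c : R) : 0 <= c ->
  (forall k, measurable_fun setT (f k)) -> (forall k, measurable_fun setT (g k)) ->
  (forall k, m1.-integrable setT (fun x => (f k x ^+ 2)%:E)) ->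
  (forall k, m2.-integrable setT (fun x => (g k x ^+ 2)%:E)) ->
  (\int[m1 \x (m2 \x m3)]_w (c * \sum_(k < d) (f k w.1 - g k w.2.1) ^+ 2)%:E)%E =
  (c * \sum_(k < d)
    (fine (\int[m1]_x (f k x ^+ 2)%:E)%E
     - 2 * fine (\int[m1]_x (f k x)%:E)%E * fine (\int[m2]_x (g k x)%:E)%E
     + fine (\int[m2]_x (g k x ^+ 2)%:E)%E))%:E.
Proof.
move=> c0 mf mg if2 ig2.
pose m23 : probability (T2 * T3)%type R := (m2 \x m3)%E.
pose m : measure (T1 * (T2 * T3))%type R := (m1 \x m23)%E.
have msq k : measurable_fun setT
    (fun w : T1 * (T2 * T3) => (f k w.1 - g k w.2.1) ^+ 2).
  apply: measurable_funX; apply: measurable_funB; first exact: measurableT_comp.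
  by apply: measurableT_comp => //; exact: measurableT_comp.
transitivity (\int[m]_w (c * \sum_(k < d) (f k w.1 - g k w.2.1) ^+ 2)%:E)%E => //.
under eq_integral do rewrite EFinM -sumEFin.
rewrite ge0_integralZl//; last 2 first.
- by apply: emeasurable_sum => k; exact/measurable_EFinP.
- by move=> w _; apply: sume_ge0 => k _; rewrite lee_fin sqr_ge0.
rewrite ge0_integral_sum//; last 2 first.
- by move=> k; exact/measurable_EFinP.
- by move=> k w _; rewrite lee_fin sqr_ge0.
rewrite EFinM -sumEFin; congr (_ * _)%E; apply: eq_bigr => k _.
exact: integral_sqr_diff.
Qed.

(** In each coordinate, E X^2 - 2 EX EY + E Y^2 = Var X + Var Y + (EX - EY)^2. *)
Lemma expectation_W2 (R : realType) (d : nat) (F G : probability (Rd R d) R) :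
  finite_second_moments F -> finite_second_moments G ->
  fine (\int[triple_law F G]_w (W2 w)%:E)%E =
  d%:R^-1 * trace_cov F + d%:R^-1 * trace_cov G +
  d%:R^-1 * \sum_(k < d) (mean_vec F k - mean_vec G k) ^+ 2.
Proof.
move=> F2 G2; rewrite /W2 /triple_law.
rewrite (integral_sum_sqr_diff _ _ _ _ _ _ _ F G G _
  (fun k x => x k) (fun k x => x k))//=; [|exact: measurable_coord..].
rewrite /trace_cov -!mulrDr -!big_split/=; congr (_ * _).
by apply: eq_bigr => k _; rewrite /mean_vec; ring.
Qed.

Lemma product_integral_ge0 (R : realType) (d1 d2 d3 : measure_display)
    (T1 : measurableType d1) (T2 : measurableType d2) (T3 : measurableType d3)
    (m1 : probability T1 R) (m2 : probability T2 R) (m3 : probability T3 R)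
    (f : T1 * (T2 * T3) -> R) : (forall w, 0 <= f w) ->
  (0 <= \int[m1 \x (m2 \x m3)]_w (f w)%:E)%E.
Proof.
move=> f0; pose m23 : probability (T2 * T3)%type R := (m2 \x m3)%E.
pose m : measure (T1 * (T2 * T3))%type R := (m1 \x m23)%E.
suff : (0 <= \int[m]_w (f w)%:E)%E by [].
by apply: integral_ge0 => w _; rewrite lee_fin.
Qed.

Lemma expectation_W2_ge0 (R : realType) (d : nat) (F G : probability (Rd R d) R) :
  0 <= fine (\int[triple_law F G]_w (W2 w)%:E)%E.
Proof.
apply: fine_ge0; apply: (product_integral_ge0 _ _ _ _ _ _ _ F G G) => w.
by rewrite mulr_ge0// sumr_ge0// => k _; exact: sqr_ge0.
Qed.

Lemma cvg_expectation_W2 (R : realType) (J : nat)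
    (F : forall d, 'I_J -> probability (Rd R d) R)
    (sigma2 : 'I_J -> R) (nu2 : 'I_J -> 'I_J -> R) (j j' : 'I_J) :
  (forall d j, finite_second_moments (F d j)) -> assumption_A2 F sigma2 nu2 ->
  (fun d => fine (\int[triple_law (F d j) (F d j')]_w (W2 w)%:E)%E) @ \oo -->
  sigma2 j + sigma2 j' + (if j == j' then 0 else nu2 j j').
Proof.
move=> F2 [cs cn]; under eq_fun do rewrite expectation_W2//.
apply: cvgD; first exact: cvgD (cs j) (cs j').
(* (A2) gives the limit off the diagonal; on it the mean difference vanishes for every [d]. *)
case: eqVneq => [<-|/cn//]; apply: cvg_near_cst; apply: nearW => d.
by rewrite big1 ?mulr0// => k _; rewrite subrr expr0n.
Qed.

(** * Convergence in probability of the scaled squared distance *)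

(** The union bound in the limit, over a finite index set that does not vary with [d]. The
    convergence arguments below cover a deviation event by events of vanishing probability and
    conclude with it. *)
Lemma cvg_probability_bigcup (R : realType) (I : finType)
    (dO : nat -> measure_display) (Omega : forall d, measurableType (dO d))
    (P : forall d, probability (Omega d) R)
    (A : forall d, set (Omega d)) (B : forall d, I -> set (Omega d)) :
  (forall d, measurable (A d)) -> (forall d i, measurable (B d i)) ->
  (\forall d \near \oo, A d `<=` \bigcup_i B d i) ->
  (forall i, (fun d => P d (B d i)) @ \oo --> 0%E) ->
  (fun d => P d (A d)) @ \oo --> 0%E.
Proof.
move=> mA mB AB B0.
have finI : finite_set [set: I] by exact: finite_finset.
pose r := finmap.enum_fset (fset_set [set: I]).
apply: (@squeeze_cvge _ _ _ R (fun=> 0%E) _ (fun d => \sum_(i <- r) P d (B d i))%E);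
  last 2 first.
- exact: cvg_cst.
- rewrite [X in _ --> X](_ : _ = \sum_(i <- r) 0)%E; last by rewrite big1.
  by apply: cvg_nnesum => // i _; apply: nearW => d; exact: measure_ge0.
near=> d; rewrite measure_ge0/= /r -fsbig_finite//.
apply: (content_sub_fsum (P d)) => //.
by near: d.
Unshelve. all: by end_near. Qed.

Lemma cvg_prob_sqdist (R : realType) (dO : nat -> measure_display)
    (Omega : forall d, measurableType (dO d)) (P : forall d, probability (Omega d) R)
    (F G : forall d, probability (Rd R d) R) (U V : forall d, Omega d -> Rd R d)
    (c : nat -> R) (s : R) :
  (forall d, has_law (P d) (U d) (F d)) -> (forall d, has_law (P d) (V d) (G d)) ->
  (forall d A B, measurable A -> measurable B ->
     P d (U d @^-1` A `&` V d @^-1` B) =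
     (P d (U d @^-1` A) * P d (V d @^-1` B))%E) ->
  cvg_prob_seq (fun d => triple_law (F d) (G d)) (@W2 R) c ->
  c @ \oo --> s ->
  cvg_prob_seq P (fun d w => d%:R^-1 * sqdist (U d w) (V d w)) (fun=> s).
Proof.
move=> lU lV ind W2c cs eps eps0.
have mUV d : measurable_fun setT (fun w => d%:R^-1 * sqdist (U d w) (V d w)).
  by apply: measurable_funM => //; apply: measurable_sqdist; [case: (lU d)|case: (lV d)].
have eps20 : 0 < eps / 2 by rewrite divr_gt0.
apply: (@cvg_probability_bigcup _ unit _ _ _ _
  (fun d _ => [set w | eps / 2 <= `|d%:R^-1 * sqdist (U d w) (V d w) - c d|])).
- by move=> d; exact: measurable_dist_ge.
- by move=> d _; exact: measurable_dist_ge.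
(* Once [c d] is within [eps / 2] of [s], a deviation of [eps] from [s] forces one of [eps / 2] from
   [c d]. *)
- near=> d => w /= epsw; exists tt => //=.
  have cd : `|s - c d| < eps / 2.
    by near: d; exact: cvgr_dist_lt cs _ eps20.
  rewrite leNgt; apply/negP => h.
  have := ler_distD (c d) (d%:R^-1 * sqdist (U d w) (V d w)) s.
  by rewrite [`|c d - s|]distrC; lra.
(* The event depends on [(U, V)] only, so its probability is that of [E] under the product law,
   hence that of the matching [W2] event under [triple_law]. *)
- move=> _; apply: cvg_trans (W2c _ eps20); apply: near_eq_cvg; apply: nearW => d.
  pose E := [set z : Rd R d * Rd R d | eps / 2 <= `|d%:R^-1 * sqdist z.1 z.2 - c d|].
  have mE : measurable E.
    apply: measurable_dist_ge; apply: measurable_funM => //.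
    exact: measurable_sqdist.
  rewrite (independent_pair_law _ _ _ _ _ _ _ _ _ (lU d) (lV d) (ind d) E mE).
  exact: product_measure_marginal2 mE.
Unshelve. all: by end_near. Qed.

(** * Continuity of the kernel and growth of the bandwidth *)

(** Extending [Psi] by its value at 0 gives a function continuous on the whole line, to which
    composition and measurability results apply directly. *)
Lemma continuous_extend0 (R : realType) (Psi : R -> R) :
  {within `[0, +oo[, continuous Psi} -> continuous (fun x : R => Psi (Num.max 0 x)).
Proof.
move=> /subspace_continuousP cPsi x.
have x0 : `[0, +oo[%classic (Num.max 0 x) by rewrite /= in_itv/= andbT le_max lexx.
have cmax : {for x, continuous (fun y : R => Num.max 0 y)}.
  by apply: (@continuous_max R R (cst 0) id); [exact: cst_continuous|exact: cvg_id].
apply: (@cvg_comp _ _ _ (fun y : R => Num.max 0 y) Psi) (cPsi _ x0) => A nA.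
(* The subspace filter speaks of nonnegative points only, a condition that [Num.max 0 y] always
   meets. *)
have /cmax cA : \forall z \near Num.max 0 x, 0 <= z -> A z.
  have {}nA : nbhs (Num.max 0 x : R) (fun z => `[0, +oo[%classic z -> A z) := nA.
  by apply: filterS nA => z zA z0; apply: zA; rewrite /= in_itv/= andbT.
have {}cA : \forall y \near (x : R), 0 <= Num.max 0 y -> A (Num.max 0 y) := cA.
suff : \forall y \near (x : R), A (Num.max 0 y) by [].
by apply: (filterS _ cA) => y; apply; rewrite le_max lexx.
Qed.

(** The deterministic core: [Psi (x / y) * x] is jointly continuous at [(s, C0)], with x = u/d and y
    = h^2/d. Since [delta] is chosen before [d] and [u], the bound holds at all sample points at
    once. *)
Lemma near_rescaled_kernel (R : realType) (Psi : R -> R) (h : nat -> R)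
    (C0 s eps : R) :
  {within `[0, +oo[, continuous Psi} -> (forall d, 0 < h d) -> 0 < C0 ->
  (fun d => h d ^+ 2 / d%:R) @ \oo --> C0 -> 0 <= s -> 0 < eps ->
  exists2 delta, 0 < delta & \forall d \near \oo, forall u, 0 <= u ->
    `|d%:R^-1 * u - s| < delta ->
    `|d%:R^-1 * (Psi (u / h d ^+ 2) * u) - Psi (s / C0) * s| < eps.
Proof.
move=> cPsi h0 C00 hC s0 eps0.
pose Psi0 x := Psi (Num.max 0 x).
pose g (z : R * R) := Psi0 (z.1 / z.2) * z.1.
have cg : {for (s, C0), continuous g}.
  apply: cvgM; last exact: cvg_fst.
  apply: (@continuous_comp _ _ _ (fun z : R * R => z.1 / z.2) Psi0).
    apply: cvgM; first exact: cvg_fst.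
    by apply: cvgV; [rewrite gt_eqF|exact: cvg_snd].
  exact: continuous_extend0.
have /cvgrPdist_lt/(_ _ eps0)/nbhs_ballP[delta/= delta0 gdelta] := cg.
exists delta => //; near=> d => u u0 us.
have d0 : 0 < d%:R :> R by rewrite ltr0n; near: d; exists 1%N.
have hd : `|C0 - h d ^+ 2 / d%:R| < delta.
  by near: d; exact: cvgr_dist_lt hC _ delta0.
have := gdelta (d%:R^-1 * u, h d ^+ 2 / d%:R).
rewrite /ball/= /prod_ball /ball/= distrC => /(_ (conj us hd)).
rewrite /g/= /Psi0 distrC.
(* The dimension cancels in the ratio of the two rescaled quantities. *)
rewrite (_ : _^-1 * u / _ = u / h d ^+ 2); last by field; rewrite !gt_eqF.
rewrite !max_r ?divr_ge0 ?sqr_ge0// 1?ltW//.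
by rewrite mulrCA.
Unshelve. all: by end_near. Qed.

Lemma measurable_kernel_term (R : realType) (Psi : R -> R) (a : R) (d : nat)
    (dT : measure_display) (T : measurableType dT) (U V : T -> Rd R d) :
  {within `[0, +oo[, continuous Psi} -> 0 <= a ->
  measurable_fun setT U -> measurable_fun setT V ->
  measurable_fun setT
    (fun w => Psi (sqdist (U w) (V w) / a) * sqdist (U w) (V w)).
Proof.
move=> cPsi a0 mU mV; have mUV := measurable_sqdist _ _ _ _ _ _ mU mV.
apply: measurable_funM => //.
pose Psi0 (x : R) := Psi (Num.max 0 x).
rewrite (_ : (fun _ => _) = Psi0 \o (fun w => sqdist (U w) (V w) / a)).
  apply: measurableT_comp; last exact: measurable_funM.
  by apply: continuous_measurable_fun; exact: continuous_extend0.
by apply/funext => w; rewrite /Psi0/= max_r// divr_ge0// sqdist_ge0.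
Qed.

(** Eventually h^2 > (C0/2) d, which exceeds 1 as soon as d >= 2/C0. This selects the first branch
    of [gamma_hat]. *)
Lemma near_bandwidth_gt1 (R : realType) (h : nat -> R) (C0 : R) :
  (forall d, 0 < h d) -> 0 < C0 ->
  (fun d => h d ^+ 2 / d%:R) @ \oo --> C0 -> \forall d \near \oo, 1 < h d.
Proof.
move=> h0 C00 hC.
have C20 : 0 < C0 / 2 by rewrite divr_gt0.
near=> d.
have d0 : 0 < d%:R :> R by rewrite ltr0n; near: d; exists 1%N.
have : `|C0 - h d ^+ 2 / d%:R| < C0 / 2.
  by near: d; exact: cvgr_dist_lt hC _ C20.
rewrite ltr_norml => /andP[_ hd].
have {}hd : C0 / 2 * d%:R < h d ^+ 2 by rewrite -ltr_pdivlMr//; lra.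
have dC : (C0 / 2)^-1 <= d%:R by near: d; exact: nbhs_infty_ger.
rewrite -(@ltr_pXn2r _ 2)// ?nnegrE ?ler01 ?(ltW (h0 d))// expr1n.
by apply: le_lt_trans hd; rewrite mulrC -ler_pdivrMr// div1r.
Unshelve. all: by end_near. Qed.

(** * Convergence of the kernel terms and of their averages *)

Lemma cvg_prob_kernel_term (R : realType) (J : nat)
    (F : forall d, 'I_J -> probability (Rd R d) R)
    (sigma2 : 'I_J -> R) (nu2 : 'I_J -> 'I_J -> R) (Psi : R -> R) (h : nat -> R)
    (C0 : R) (dO : nat -> measure_display) (Omega : forall d, measurableType (dO d))
    (P : forall d, probability (Omega d) R) (U V : forall d, Omega d -> Rd R d)
    (j k : 'I_J) :
  (forall d j, finite_second_moments (F d j)) ->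
  assumption_A1 F -> assumption_A2 F sigma2 nu2 ->
  {within `[0, +oo[, continuous Psi} -> (forall d, 0 < h d) -> 0 < C0 ->
  (fun d => h d ^+ 2 / d%:R) @ \oo --> C0 ->
  (forall d, has_law (P d) (U d) (F d j)) ->
  (forall d, has_law (P d) (V d) (F d k)) ->
  (forall d A B, measurable A -> measurable B ->
     P d (U d @^-1` A `&` V d @^-1` B) =
     (P d (U d @^-1` A) * P d (V d @^-1` B))%E) ->
  cvg_prob_seq P
    (fun d w => d%:R^-1 * (Psi (sqdist (U d w) (V d w) / h d ^+ 2) *
                           sqdist (U d w) (V d w)))
    (fun=> theta0 Psi C0 sigma2 nu2 j k).
Proof.
move=> F2 A1 A2 cPsi h0 C00 hC lU lV ind eps eps0.
rewrite /theta0; set s := _ + _ + _.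
have [_ W2c] := A1 j k.
have cs := cvg_expectation_W2 _ _ _ _ _ j k F2 A2; rewrite -/s in cs.
(* The constants of (A2) come with no sign; [s] is nonnegative as a limit of expectations of
   squares, which places it where [Psi] is continuous. *)
have s0 : 0 <= s.
  rewrite -(cvg_lim _ cs)//; apply: limr_ge; first exact: cvgP cs.
  by apply: nearW => d; exact: expectation_W2_ge0.
have [delta delta0 near_delta] :=
  near_rescaled_kernel _ _ _ _ _ _ cPsi h0 C00 hC s0 eps0.
have mU d : measurable_fun setT (U d) by case: (lU d).
have mV d : measurable_fun setT (V d) by case: (lV d).
apply: (@cvg_probability_bigcup _ unit _ _ _ _
  (fun d _ => [set w | delta <= `|d%:R^-1 * sqdist (U d w) (V d w) - s|])).
- move=> d; apply: measurable_dist_ge; apply: measurable_funM => //.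
  by apply: measurable_kernel_term => //; exact: sqr_ge0.
- move=> d _; apply: measurable_dist_ge; apply: measurable_funM => //.
  exact: measurable_sqdist.
- apply: filterS near_delta => d near_delta w /= epsw; exists tt => //=.
  rewrite leNgt; apply/negP => /(near_delta _ (sqdist_ge0 _ _ _ _)).
  by rewrite ltNge epsw.
- move=> _; exact: (cvg_prob_sqdist _ _ _ _ _ _ _ _ _ _ lU lV ind W2c cs).
Qed.

(** The exceptional events are indexed by all pairs (k, l), finitely many; outside them each average
    is close to the average of the limits. Letting [t] depend on [l] allows for a summand that pairs
    a point with itself. *)
Lemma cvg_vec_prob_gamma_hat (R : realType) (J : nat) (n : 'I_J -> nat)
    (Psi : R -> R) (h : nat -> R) (C0 : R)
    (dO : nat -> measure_display) (Omega : forall d, measurableType (dO d))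
    (P : forall d, probability (Omega d) R)
    (X : forall d (k : 'I_J), 'I_(n k) -> Omega d -> Rd R d)
    (U : forall d, Omega d -> Rd R d) (t : forall k, 'I_(n k) -> R) :
  (forall k, (0 < n k)%N) ->
  {within `[0, +oo[, continuous Psi} -> (forall d, 0 < h d) -> 0 < C0 ->
  (fun d => h d ^+ 2 / d%:R) @ \oo --> C0 ->
  (forall d, measurable_fun setT (U d)) ->
  (forall d k l, measurable_fun setT (X d k l)) ->
  (forall k (l : 'I_(n k)), cvg_prob_seq P
    (fun d w => d%:R^-1 * (Psi (sqdist (U d w) (X d k l w) / h d ^+ 2) *
                           sqdist (U d w) (X d k l w)))
    (fun=> t k l)) ->
  cvg_vec_prob P
    (fun d w k => d%:R^-1 * gamma_hat Psi (h d) (fun l => X d k l w) (U d w))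
    (fun k => (n k)%:R^-1 * \sum_(l < n k) t k l).
Proof.
move=> n0 cPsi h0 C00 hC mU mX ct eps eps0.
pose term d (p : {k : 'I_J & 'I_(n k)}) w :=
  Psi (sqdist (U d w) (X d (tag p) (tagged p) w) / h d ^+ 2) *
  sqdist (U d w) (X d (tag p) (tagged p) w).
have mterm d p : measurable_fun setT (term d p).
  by apply: measurable_kernel_term => //; exact: sqr_ge0.
have eps20 : 0 < eps / 2 by rewrite divr_gt0.
apply: (@cvg_probability_bigcup _ {k : 'I_J & 'I_(n k)} _ _ _ _
  (fun d p => [set w | eps / 2 <= `|d%:R^-1 * term d p w - t (tag p) (tagged p)|])).
- move=> d; rewrite (_ : [set _ | _] = \bigcup_k [set w | eps <= `|d%:R^-1 *
    gamma_hat Psi (h d) (fun l => X d k l w) (U d w) -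
    (n k)%:R^-1 * \sum_(l < n k) t k l|]); last first.
    by apply/seteqP; split => w /= [k]; [exists k|move=> _ ?; exists k].
  apply: fin_bigcup_measurable; first exact: finite_finset.
  move=> k _; apply: measurable_dist_ge; apply: measurable_funM => //.
  have mbeta : measurable_fun setT
      (fun w => beta_hat Psi (h d) (fun l => X d k l w) (U d w)).
    apply: measurable_funM => //; apply: measurable_sum => l.
    exact: (mterm d (Tagged (fun k => 'I_(n k)) l)).
  by rewrite /gamma_hat; case: (1 < h d) => //; exact: measurable_funM.
- by move=> d p; apply: measurable_dist_ge; exact: measurable_funM.
- have := near_bandwidth_gt1 _ _ _ h0 C00 hC; apply: filterS => d h1 w /= [k].
  rewrite /gamma_hat h1 /beta_hat => epsw; apply: contrapT => small.
  have {}small (l : 'I_(n k)) :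
      `|d%:R^-1 * term d (Tagged (fun k => 'I_(n k)) l) w - t k l| <= eps / 2.
    rewrite leNgt; apply/negP => /ltW big; apply: small.
    by exists (Tagged (fun k => 'I_(n k)) l).
  move: epsw; rewrite mulrCA -mulrBr mulr_sumr -sumrB normrM ger0_norm ?invr_ge0//.
  apply/negP; rewrite -ltNge mulrC ltr_pdivrMr ?ltr0n//.
  apply: le_lt_trans (ler_norm_sum _ _ _) _.
  (* As [n k] is positive, [n k] copies of [eps / 2] add up to strictly less than [n k] times
     [eps]. *)
  apply: (@le_lt_trans _ _ (\sum_(l < n k) eps / 2)).
    by apply: ler_sum => l _; exact: small.
  rewrite sumr_const card_ord -[X in X < _]mulr_natr ltr_pM2r ?ltr0n//.
  by rewrite ltr_pdivrMr// ltr_pMr// ltr1n.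
- by move=> p; exact: ct.
Qed.

(** * Limits at a sample point and at an independent observation *)

Theorem theorem4 (R : realType) (J : nat) (n : 'I_J -> nat)
  (hJ : (2 <= J)%N) (hn : forall j, (2 <= n j)%N)
  (F : forall d, 'I_J -> probability (Rd R d) R)
  (hF2 : forall d j, finite_second_moments (F d j))
  (sigma2 : 'I_J -> R) (nu2 : 'I_J -> 'I_J -> R)
  (hA1 : assumption_A1 F) (hA2 : assumption_A2 F sigma2 nu2)
  (Psi : R -> R) (hPsi_cont : {within `[0, +oo[, continuous Psi})
  (hPsi_ge0 : forall x, 0 <= x -> 0 <= Psi x)
  (hPsi_dec : {in `[0, +oo[ &, {homo Psi : x y /~ x <= y}})
  (h : nat -> R) (h_gt0 : forall d, 0 < h d) (C0 : R) (hC0 : 0 < C0)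
  (hh : (fun d => h d ^+ 2 / d%:R) @ \oo --> C0)
  (dO : nat -> measure_display) (Omega : forall d, measurableType (dO d))
  (P : forall d, probability (Omega d) R)
  (X : forall d (j : 'I_J), 'I_(n j) -> Omega d -> Rd R d)
  (hlaw : forall d j i, has_law (P d) (X d j i) (F d j))
  (hind : forall d, mutually_independent (P d)
            (fun p : {j : 'I_J & 'I_(n j)} => X d (tag p) (tagged p))) :
  (* (a) *)
  (forall (j : 'I_J) (i : 'I_(n j)),
     cvg_vec_prob P
       (fun d w k => d%:R^-1 * gamma_hat Psi (h d) (fun l => X d k l w) (X d j i w))
       (fun k => if k == j then (1 - (n j)%:R^-1) * theta0 Psi C0 sigma2 nu2 j j
                 else theta0 Psi C0 sigma2 nu2 j k))
  /\
  (* (b) *)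
  (forall (c : 'I_J) (Z : forall d, Omega d -> Rd R d),
     (forall d, has_law (P d) (Z d) (F d c)) ->
     (forall d, mutually_independent (P d)
        (fun p : option {j : 'I_J & 'I_(n j)} =>
           match p with None => Z d | Some q => X d (tag q) (tagged q) end)) ->
     cvg_vec_prob P
       (fun d w k => d%:R^-1 * gamma_hat Psi (h d) (fun l => X d k l w) (Z d w))
       (fun k => theta0 Psi C0 sigma2 nu2 c k)).
Proof.
have n0 k : (0 < n k)%N by rewrite (leq_trans _ (hn k)).
have nn0 k : (n k)%:R != 0 :> R by rewrite pnatr_eq0 -lt0n.
have mX d k l : measurable_fun setT (X d k l) by case: (hlaw d k l).
split=> [j i|c Z lZ indZ].
(* Indices in different samples have different types; tagging makes the comparison of (k, l) with
   (j, i) meaningful. *)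
- pose q := Tagged (fun j => 'I_(n j)) i.
  pose t k (l : 'I_(n k)) : R :=
    if Tagged (fun j => 'I_(n j)) l == q then 0 else theta0 Psi C0 sigma2 nu2 j k.
  rewrite (_ : (fun k => _) = (fun k => (n k)%:R^-1 * \sum_(l < n k) t k l)).
    apply: (@cvg_vec_prob_gamma_hat _ _ _ _ _ C0) => // k l; rewrite /t.
    case: (eqVneq (Tagged (fun j => 'I_(n j)) l) q) => [lq|lq].
    (* The point is paired with itself: its distance is 0 and the term vanishes identically. *)
    + have lX d w : X d k l w = X d j i w.
        by have := congr1 (fun p => X d (tag p) (tagged p) w) lq.
      move=> eps eps0; apply: cvg_near_cst; apply: nearW => d.
      rewrite (_ : [set _ | _] = set0) ?measure0//; apply/seteqP; split => w //=.
      rewrite lX /sqdist big1 => [|m _]; last by rewrite subrr expr0n.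
      by rewrite !mulr0 subr0 normr0 leNgt eps0.
    + apply: (@cvg_prob_kernel_term _ _ F) => // d A B mA mB.
      rewrite eq_sym in lq.
      exact: (mutually_independent_pair _ _ _ _ _ _ _ _ _ _ _ (hind d) lq).
  apply/funext => k; case: eqVneq => [->|kj].
    (* The self-pairing contributes 0, leaving [n j - 1] equal terms out of [n j]. *)
    rewrite (bigD1 i)//= {1}/t eqxx add0r.
    rewrite (eq_bigr (fun=> theta0 Psi C0 sigma2 nu2 j j)) => [|l li]; last first.
      by rewrite /t ifN// eq_Tagged.
    rewrite sumr_const cardC1 card_ord; move: (theta0 _ _ _ _ _ _) => th.
    by rewrite -[th *+ _]mulr_natl -subn1 natrB// mulrA mulrBr mulVf// mulr1.
  rewrite (eq_bigr (fun=> theta0 Psi C0 sigma2 nu2 j k)) => [|l _].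
    rewrite sumr_const card_ord; move: (theta0 _ _ _ _ _ _) => th.
    by rewrite -[th *+ _]mulr_natl mulKf.
  by rewrite /t ifN//; apply: contraNneq kj => /(congr1 tag)/= ->.
- rewrite (_ : (fun k => _) =
      (fun k => (n k)%:R^-1 * \sum_(l < n k) theta0 Psi C0 sigma2 nu2 c k)); last first.
    apply/funext => k; rewrite sumr_const card_ord; move: (theta0 _ _ _ _ _ _) => th.
    by rewrite -[th *+ _]mulr_natl mulKf.
  apply: (@cvg_vec_prob_gamma_hat _ _ _ _ _ C0) => // [d|k l]; first by case: (lZ d).
  (* [Z] sits at index [None], distinct from every sample index, so no summand is exceptional. *)
  apply: (@cvg_prob_kernel_term _ _ F) => // d A B mA mB.
  exact: (mutually_independent_pair _ _ _ _ _ _ _ None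
    (Some (Tagged (fun j => 'I_(n j)) l)) _ _ (indZ d)).
Qed.
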